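(* Let $T_1,\dots,T_d$ be commuting, measure-preserving, bijective maps on a probability space $(\Omega,\mathcal F,\mathbb P)$, and let $T^j:=T_1^{j_1}\circ\cdots\circ T_d^{j_d}$ for $j=(j_1,\dots,j_d)\in\mathbb Z^d$. Fix $\kappa\in[1,+\infty]$ and let $|\cdot|$ be the $\ell^\kappa$-norm on $\mathbb R^d$. Let $\vartheta:\mathbb R_+\to\mathbb R_+$ be a $d$-good function and let $\rho:\mathbb N\to(0,+\infty)$ be a summable function with $\sum_{m=0}^\infty m^{2d}\vartheta(m)\rho(m)^{-1}<+\infty$. Then there is a positive constant $C=C(d,\vartheta,\rho,\kappa)$, depending only on $d,\vartheta,\rho,\kappa$, such that for every function $\psi:\mathbb R^d\to\mathbb R_+$ with $\psi(x)\le\vartheta(|x|)$ for all $x\in\mathbb R^d$, every non-negative $f\in L^1(\Omega,\mathcal F,\mathbb P)$ and every $\alpha>0$, $$\mathbb P\Big(\sup_{n\ge1}\frac1{n^d}\sum_{j\in\mathbb Z^d}\psi(j/n)\,f(T^j\omega)>\alpha\Big)\le\frac{C\,\|f\|_1}{\alpha}.$$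
   Context: $\mathbb R_+=[0,+\infty)$; $\mathbb N=\{0,1,2,\dots\}$; $n$ ranges over positive integers. The maps $T_i$ and their inverses are measurable and preserve $\mathbb P$, so that $(T^j)_{j\in\mathbb Z^d}$ is a measure-preserving action of $\mathbb Z^d$. Definition. A function $\vartheta:\mathbb R_+\to\mathbb R_+$ is called $d$-good if it is non-increasing and $\sum_{m=0}^\infty m^{2d}\vartheta(m)\rho(m)^{-1}<+\infty$ for some positive summable function $\rho:\mathbb N\to(0,+\infty)$. *)

(* Defs.v *)
From HB Require Import structures.
From mathcomp Require Import all_boot all_order all_algebra.
From mathcomp Require Import all_classical all_reals all_analysis.

Set Implicit Arguments.
Unset Strict Implicit.
Unset Printing Implicit Defensive.

Import Order.TTheory GRing.Theory Num.Theory.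
Import numFieldNormedType.Exports.

Local Open Scope classical_set_scope.
Local Open Scope ring_scope.

(* Functions on [0, +oo[ are total functions on R whose values outside
   [0, +oo[ are irrelevant. *)
Definition good_weight (R : realType) (d : nat) (theta : R -> R)
    (rho : nat -> R) : Prop :=
  [/\ forall m, 0 < rho m,
      (\sum_(0 <= m <oo) (rho m)%:E < +oo)%E
    & (\sum_(0 <= m <oo)
         (m%:R ^+ (2 * d) * theta m%:R * (rho m)^-1)%:E < +oo)%E].

Definition d_good (R : realType) (d : nat) (theta : R -> R) : Prop :=
  [/\ forall x, 0 <= x -> 0 <= theta x,
      forall x y, 0 <= x -> x <= y -> theta y <= theta x
    & exists rho : nat -> R, good_weight d theta rho].

(* The value at kappa = -oo is junk; only 1 <= kappa is meaningful. *)
Definition lnorm (R : realType) (d : nat) (kappa : \bar R) (x : 'rV[R]_d) : R :=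
  match kappa with
  | p%:E => (\sum_(i < d) `|x ord0 i| `^ p) `^ p^-1
  | +oo%E => \big[Num.max/0]_(i < d) `|x ord0 i|
  | -oo%E => 0
  end.

Definition measure_preserving (R : realType) (disp : measure_display)
    (Omega : measurableType disp) (P : probability Omega R)
    (g : Omega -> Omega) : Prop :=
  measurable_fun setT g /\
  forall A : set Omega, measurable A -> P (g @^-1` A) = P A.

Definition iterz (X : Type) (g ginv : X -> X) (k : int) : X -> X :=
  match k with
  | Posz m => iter m g
  | Negz m => iter m.+1 ginv
  end.

(* T^j = T_1^{j_1} \o ... \o T_d^{j_d}, where Tinv i is the inverse of T i. *)
Definition Zd_action (X : Type) (d : nat) (T Tinv : 'I_d -> X -> X)
    (j : 'rV[int]_d) : X -> X :=
  \big[(fun g h => g \o h)/id]_(i < d) iterz (T i) (Tinv i) (j ord0 i).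

(* Main.v *)
(* Cutting R^d into the shells m <= |x| < m + 1 and using the monotonicity of
   theta, the weighted average at scale n is at most the sum over m of
   theta m * (m + 1) ^ d times the average of f along the cube of radius
   n * (m + 1).  The d-goodness makes the sum K of these coefficients finite, so
   the weighted maximal function is at most a multiple of K times the maximal
   function of averages over cubes, and it suffices to bound the latter.  For
   this, Vitali's covering lemma in Z^d is applied to the orbit of a point,
   restricted to a cube of radius 2 L when only cubes of radius at most L are
   averaged over; by invariance of the measure, integration yields a bound
   uniform in L. *)

Require Import Defs.
From HB Require Import structures.
From mathcomp Require Import all_boot all_order all_algebra.
From mathcomp Require Import finmap zify ring.
From mathcomp Require Import all_classical all_reals all_analysis.

Set Implicit Arguments.
Unset Strict Implicit.
Unset Printing Implicit Defensive.

Import Order.TTheory GRing.Theory Num.Theory.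
Import numFieldNormedType.Exports.
Import measurable_realfun.

Local Open Scope classical_set_scope.
Local Open Scope ring_scope.

(** * Boxes in $\mathbb Z^d$ and Vitali covering *)

Section Box.
Variable d : nat.
Implicit Types (c j : 'rV[int]_d) (N : nat).

Definition box_pt N (h : {ffun 'I_d -> 'I_(N.*2)}) : 'rV[int]_d :=
  \row_i ((h i)%:Z - N%:Z).

(* Half-open: c_i - N <= j_i < c_i + N, so that the box has (2 N) ^ d points. *)
Definition box c N : {fset 'rV[int]_d} :=
  [fset (c + box_pt h)%R | h in {: {ffun 'I_d -> 'I_(N.*2)}}]%fset.

Lemma box_pt_inj c N : injective (fun h => c + @box_pt N h).
Proof.
move=> h1 h2 /addrI /rowP e; apply/ffunP => i; apply/val_inj => /=.
by have := e i; rewrite !mxE => /addIr [].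
Qed.

Lemma in_boxP c N j :
  reflect (forall i, c ord0 i - N%:Z <= j ord0 i < c ord0 i + N%:Z)
    (j \in box c N).
Proof.
apply: (iffP idP) => [/imfsetP[h _ ->] i|H].
  rewrite !mxE; have := ltn_ord (h i).
  by move: (c _ _) (h i : nat) => a b; lia.
have hN i : (absz (j ord0 i - c ord0 i + N%:Z)%R < N.*2)%N.
  by have := H i; move: (c _ _) (j _ _) => a b; lia.
apply/imfsetP; exists [ffun i => Ordinal (hN i)] => //=.
apply/rowP => i; rewrite !mxE ffunE /=; have := H i.
by move: (c _ _) (j _ _) => a b; lia.
Qed.

Lemma big_box (V : nmodType) c N (F : 'rV[int]_d -> V) :
  \sum_(j <- box c N) F j =
  \sum_(h : {ffun 'I_d -> 'I_(N.*2)}) F (c + box_pt h).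
Proof.
rewrite big_imfset /=; last by move=> ? ? _ _; exact: box_pt_inj.
by rewrite big_enum.
Qed.

Lemma card_box c N : #|` box c N| = ((N.*2) ^ d)%N.
Proof.
rewrite card_imfset; last exact: box_pt_inj.
by rewrite -cardE card_ffun !card_ord.
Qed.

End Box.

Lemma big_fsetDS (V : nmodType) (K : choiceType) (A B : {fset K}) (F : K -> V) :
  (A `<=` B)%fset ->
  \sum_(x <- B) F x = \sum_(x <- A) F x + \sum_(x <- (B `\` A)%fset) F x.
Proof.
move=> /fsubsetP AB; rewrite (big_fsetID _ (mem A)) /=.
congr (_ + _); congr (bigop.body _ _ _); congr enum_fset; apply/fsetP => x.
  by rewrite !inE /=; apply/andP/idP => [[]//|xA]; rewrite AB.
by rewrite !inE /= andbC.
Qed.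

(* Vitali's greedy selection, run as an induction: a box of largest radius is
   removed together with all the centers whose box meets it; these centers lie
   in the box with twice the radius. *)
Lemma box_covering (R : realDomainType) d (F : 'rV[int]_d -> R) (a : R)
    (r : 'rV[int]_d -> nat) (S B : {fset 'rV[int]_d}) :
  (forall j, 0 <= F j) -> 0 <= a ->
  {in S, forall c, (0 < r c)%N} ->
  {in S, forall c, (box c (r c) `<=` B)%fset} ->
  {in S, forall c, a * (r c)%:R ^+ d <= \sum_(j <- box c (r c)) F j} ->
  a * #|` S|%:R <= 4 ^+ d * \sum_(j <- B) F j.
Proof.
move=> F0 a0; have [n] := ubnP #|` S|.
(* [B] varies in the induction along with [S]: the boxes left after removing one box lie in its
   complement. *)
elim: n => // n IHn in S B *; rewrite ltnS => Sn r0 rB rF.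
have [->|/fset0Pn[c0 c0S]] := eqVneq S fset0.
  by rewrite cardfs0 mulr0 mulr_ge0 ?exprn_ge0 ?sumr_ge0.
have [c cS cmax] : exists2 c, c \in S & {in S, forall s, (r s <= r c)%N}.
  case: (@arg_maxnP S [` c0S]%fset xpredT (r \o val)) => // c _ cmax.
  by exists (val c) => [|s sS]; [exact: valP|exact: (cmax [` sS]%fset)].
pose Q := box c (r c).
pose S1 := [fset s in S | [disjoint box s (r s) & Q]%fset]%fset.
have S1S : (S1 `<=` S)%fset by apply/fsubsetP => s; rewrite !inE => /andP[].
(* If the box of [s] meets [Q], each coordinate of [s] differs from that of [c] by less than
   [r s + r c], which is at most [2 * r c]. *)
have SS1 : (S `\` S1 `<=` box c (r c).*2)%fset.
  apply/fsubsetP => s; rewrite !inE => /andP[+ sS]; rewrite sS /=.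
  case/fset0Pn => j /fsetIP[/in_boxP js /in_boxP jc]; apply/in_boxP => i.
  have := js i; have := jc i; have := cmax s sS.
  by move: (s _ _) (c _ _) (j _ _) => x y z; lia.
have card_diff : (#|` (S `\` S1)%fset| <= 4 ^ d * r c ^ d)%N.
  rewrite -expnMn (_ : 4 * r c = (r c).*2.*2)%N; last lia.
  by rewrite -(card_box c); exact: fsubset_leq_card.
(* Since [r c] is positive, [c] lies in its own box [Q], so [c] is removed and the size drops. *)
have cardS1 : (#|` S1| < n)%N.
  apply: leq_trans Sn; apply: fproper_ltn_card; rewrite fproperE S1S /=.
  apply/fsubsetPn; exists c => //; rewrite !inE cS /=; apply/fset0Pn; exists c.
  rewrite fsetIid; apply/in_boxP => i; have := r0 c cS.
  by move: (c _ _) => x; lia.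
have IH : a * #|` S1|%:R <= 4 ^+ d * \sum_(j <- (B `\` Q)%fset) F j.
  apply: IHn => // s sS1; have sS := fsubsetP S1S _ sS1.
  - exact: r0.
  - rewrite fsubsetD rB //=; move: sS1; rewrite !inE => /andP[_].
    exact.
  - exact: rF.
(* The removed centers are paid for by the sum over [Q], the others by the sum over the rest of
   [B]. *)
rewrite (big_fsetDS _ (rB c cS)) mulrDr -(cardfsID S1) (fsetIidPr S1S).
rewrite natrD mulrDr addrC lerD //.
apply: (@le_trans _ _ (a * (4 ^ d * r c ^ d)%:R)).
  by rewrite ler_wpM2l // ler_nat.
by rewrite natrM !natrX mulrCA ler_wpM2l ?exprn_ge0 ?rF.
Qed.

(** * Additivity of the $\mathbb Z^d$-action *)

Section Action.
Variable X : Type.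
Implicit Types f g ginv : X -> X.

Lemma comm_inv f g ginv : cancel g ginv -> cancel ginv g ->
  f \o g =1 g \o f -> f \o ginv =1 ginv \o f.
Proof.
move=> gK gVK fg w /=; rewrite -{2}(gVK w).
by have /= -> := fg (ginv w); rewrite gK.
Qed.

Lemma comm_iterz f g ginv k : cancel g ginv -> cancel ginv g ->
  f \o g =1 g \o f -> f \o iterz g ginv k =1 iterz g ginv k \o f.
Proof.
have H h n : f \o h =1 h \o f -> f \o iter n h =1 iter n h \o f.
  move=> fh; elim: n => // n IH w /=.
  by have /= -> := fh (iter n h w); have /= -> := IH w.
by move=> gK gVK fg; case: k => n; apply: H => //; exact: comm_inv.
Qed.

(** The one-step rules for $k+1$ and $k-1$ hold across the change of sign because [g] and [ginv]
    cancel; induction on [k] then gives the general case. *)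
Lemma iterzD g ginv : cancel g ginv -> cancel ginv g ->
  forall k l, iterz g ginv (k + l) =1 iterz g ginv k \o iterz g ginv l.
Proof.
move=> gK gVK.
have S k w : iterz g ginv (k + 1) w = g (iterz g ginv k w).
  case: k => [n|[|n]]; [by rewrite -PoszD addn1|by rewrite /= gVK|].
  by rewrite (_ : Negz n.+1 + 1 = Negz n) /= ?gVK //; lia.
have P k w : iterz g ginv (k - 1) w = ginv (iterz g ginv k w).
  by rewrite -{2}(subrK 1 k) S gK.
move=> k l w /=; elim: k => [|n IH|n IH].
- by rewrite add0r.
- by rewrite [RHS]/= -[iter n g _]/(iterz g ginv n _) -IH -S; congr iterz; lia.
- have -> : - n.+1%:Z + l = - n%:Z + l - 1 by lia.
  have -> : - n.+1%:Z = - n%:Z - 1 by lia.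
  by rewrite !P IH.
Qed.


Lemma comm_big_comp (I : Type) (r : seq I) f (v : I -> X -> X) :
  (forall i, f \o v i =1 v i \o f) ->
  f \o \big[(fun g h => g \o h)/id]_(i <- r) v i =1
  \big[(fun g h => g \o h)/id]_(i <- r) v i \o f.
Proof.
move=> fv; elim: r => [|i r IH] w /=; first by rewrite !big_nil.
by rewrite !big_cons /= -[RHS]/(v i ((_ \o f) w)) -IH; exact: fv.
Qed.

(** Each [v i] is moved to the right past all the later factors [u k], with which it commutes. *)
Lemma big_comp_split (I : Type) (r : seq I) (u v : I -> X -> X) :
  (forall i k, u i \o v k =1 v k \o u i) ->
  \big[(fun g h => g \o h)/id]_(i <- r) (u i \o v i) =1
  (\big[(fun g h => g \o h)/id]_(i <- r) u i) \o
  (\big[(fun g h => g \o h)/id]_(i <- r) v i).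
Proof.
move=> uv; elim: r => [|i r IH] w; first by rewrite !big_nil.
rewrite !big_cons /= IH /=; congr (u i _).
by apply: (@comm_big_comp I r (v i)) => k w'; rewrite -uv.
Qed.

Lemma Zd_actionD d (T Tinv : 'I_d -> X -> X) :
  (forall i, cancel (T i) (Tinv i)) -> (forall i, cancel (Tinv i) (T i)) ->
  (forall i k, T i \o T k =1 T k \o T i) ->
  forall j l w, Zd_action T Tinv (j + l) w =
    Zd_action T Tinv j (Zd_action T Tinv l w).
Proof.
move=> TK TVK Tcomm j l w; rewrite /Zd_action.
transitivity ((\big[(fun g h => g \o h)/id]_(i < d)
    (iterz (T i) (Tinv i) (j ord0 i) \o iterz (T i) (Tinv i) (l ord0 i))) w).
  congr (_ w); apply: eq_bigr => i _; rewrite mxE.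
  by apply/funext; exact: iterzD.
apply: big_comp_split => i k; apply: comm_iterz => // w'.
by apply/esym; apply: comm_iterz => // ?; exact: Tcomm.
Qed.

End Action.

(** * Measure-preserving maps *)

Section MeasurePreserving.
Context (R : realType) (disp : measure_display) (Omega : measurableType disp)
  (P : probability Omega R).
Implicit Types (g h : Omega -> Omega).

Lemma measure_preserving_id : measure_preserving P id.
Proof. by split; first exact: measurable_id. Qed.

Lemma measure_preserving_comp g h : measure_preserving P g ->
  measure_preserving P h -> measure_preserving P (g \o h).
Proof.
move=> [mg Pg] [mh Ph]; split; first exact: measurableT_comp.
move=> A mA; rewrite comp_preimage Ph ?Pg //.
by rewrite -[X in measurable X]setTI; exact: mg.
Qed.

Lemma measure_preserving_iterz g ginv k : measure_preserving P g ->
  measure_preserving P ginv -> measure_preserving P (iterz g ginv k).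
Proof.
move=> Pg Pginv.
have H h n : measure_preserving P h -> measure_preserving P (iter n h).
  move=> Ph; elim: n => [|n IH]; first exact: measure_preserving_id.
  exact: measure_preserving_comp.
by case: k => n; exact: H.
Qed.

Lemma measure_preserving_Zd_action d (T Tinv : 'I_d -> Omega -> Omega) j :
  (forall i, measure_preserving P (T i)) ->
  (forall i, measure_preserving P (Tinv i)) ->
  measure_preserving P (Zd_action T Tinv j).
Proof.
move=> PT PTinv; rewrite /Zd_action; apply: big_ind => [|g h|i _].
- exact: measure_preserving_id.
- exact: measure_preserving_comp.
- exact: measure_preserving_iterz.
Qed.

Lemma measure_preserving_integral g (f : Omega -> \bar R) :
  measure_preserving P g -> measurable_fun setT f -> (forall w, 0 <= f w)%E ->
  (\int[P]_w f (g w) = \int[P]_w f w)%E.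
Proof.
move=> [mg Pg] mf f0.
have /esym := ge0_integral_pushforward mg P measurableT mf (fun w _ => f0 w).
rewrite preimage_setT => ->.
by apply: eq_measure_integral => A mA _; exact: Pg.
Qed.

End MeasurePreserving.

(** * The maximal inequality for averages over boxes *)

Section MaximalInequality.
Context (R : realType) (disp : measure_display) (Omega : measurableType disp)
  (P : probability Omega R) (d : nat) (T Tinv : 'I_d -> Omega -> Omega).
Hypothesis TK : forall i, cancel (T i) (Tinv i).
Hypothesis TVK : forall i, cancel (Tinv i) (T i).
Hypothesis PT : forall i, measure_preserving P (T i).
Hypothesis PTinv : forall i, measure_preserving P (Tinv i).
Hypothesis Tcomm : forall i k, T i \o T k =1 T k \o T i.
Variable f : Omega -> R.
Hypothesis mf : measurable_fun setT f.
Hypothesis f0 : forall w, 0 <= f w.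

Local Notation act := (Zd_action T Tinv).

Definition box_sum N w := \sum_(j <- box 0 N) f (act j w).

(** Averages are normalised by $N^d$ rather than by the number $(2N)^d$ of points, and the radius is
    truncated at [L] so that only a finite piece of the orbit matters. *)
Definition exceed a L :=
  [set w | exists2 N, (0 < N <= L)%N & a * N%:R ^+ d < box_sum N w].

Lemma box_sum_act c N w :
  box_sum N (act c w) = \sum_(j <- box c N) f (act j w).
Proof.
rewrite /box_sum !big_box; apply: eq_bigr => h _.
by rewrite -Zd_actionD // add0r addrC.
Qed.

Lemma measurable_act j : measurable_fun setT (act j).
Proof. by have [] := measure_preserving_Zd_action j PT PTinv. Qed.

Lemma measurable_act_sum (X : {fset 'rV[int]_d}) (b : 'rV[int]_d -> R) :
  measurable_fun setT (fun w => \sum_(j <- X) b j * f (act j w)).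
Proof.
apply: measurable_sum => j; apply: measurable_funM; first exact: measurable_cst.
by apply: measurableT_comp; [exact: mf|exact: measurable_act].
Qed.

Lemma measurable_gt (g : Omega -> R) a :
  measurable_fun setT g -> measurable [set w | a < g w].
Proof.
move=> mg; rewrite (_ : [set _ | _] = g @^-1` `]a, +oo[); last first.
  by apply/seteqP; split => w /=; rewrite in_itv /= andbT.
by rewrite -[X in measurable X]setTI; exact: mg.
Qed.

Lemma measurable_exceed a L : measurable (exceed a L).
Proof.
rewrite (_ : exceed a L = \bigcup_(N in [set N | (0 < N <= L)%N])
    [set w | a * N%:R ^+ d < box_sum N w]); last first.
  by apply/seteqP; split => w [N]; exists N.
apply: bigcup_measurable => N _; apply: measurable_gt.
have := measurable_act_sum (box 0 N) (fun=> 1).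
by apply: eq_measurable_fun => w _; apply: eq_bigr => j _; rewrite mul1r.
Qed.

(** Transference to $\mathbb Z^d$: the covering lemma is applied to [f] along the orbit of [w], each
    bad center carrying a radius at which its box sum is large. *)
Lemma exceed_count a L w : 0 <= a ->
  a * \sum_(c <- box 0 L) \1_(exceed a L) (act c w) <=
  4 ^+ d * \sum_(j <- box 0 L.*2) f (act j w).
Proof.
move=> a0.
pose E c :=
  [set N | (0 < N <= L)%N /\ a * N%:R ^+ d < box_sum N (act c w)].
(* The default 1 is never taken at a center in [S], where [E c] is inhabited. *)
pose r c := xget 1%N (E c).
pose S := [fset c in box 0 L | `[< exceed a L (act c w) >]]%fset.
have rE c : c \in S -> E c (r c).
  rewrite !inE => /andP[_ /asboolP[N N1 N2]].
  by apply: xgetPex; exists N.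
have -> : \sum_(c <- box 0 L) \1_(exceed a L) (act c w) = #|` S|%:R :> R.
  rewrite -sum1_size natr_sum big_fset /= [RHS]big_mkcond /=.
  apply: eq_bigr => c _; rewrite indicE.
  by rewrite -[_ \in _]/(`[< exceed a L (act c w) >]); case: ifP.
apply: (@box_covering _ d (fun j => f (act j w)) a r) => // c cS;
  have [/andP[r1 r2] r3] := rE c cS => //.
  move: cS; rewrite !inE => /andP[/in_boxP cL _].
  apply/fsubsetP => j /in_boxP jc; apply/in_boxP => i.
  have := cL i; have := jc i; rewrite mxE.
  by move: (r c) r2 (c _ _) (j _ _) => n nL x y; lia.
by rewrite -box_sum_act ltW.
Qed.

(** Integrating the pointwise count gives $(2L)^d\,\mathbb P(E)\le(4^d/a)(4L)^d\int f$; the quotient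
    $2^d$ of the two cardinals turns $4^d$ into $8^d$, whatever [L] is. *)
Lemma exceed_bound a L : 0 < a ->
  (P (exceed a L) <= (8 ^+ d / a)%:E * \int[P]_w (f w)%:E)%E.
Proof.
(* The case $L=0$ is set apart because $(2L)^d$ is cancelled below. *)
move=> a0; have [->|L0] := posnP L.
  rewrite (_ : exceed a 0 = set0) ?measure0.
    apply: mule_ge0; last by apply: integral_ge0 => w _; rewrite lee_fin.
    by rewrite lee_fin divr_ge0 ?exprn_ge0 // ltW.
  by rewrite -subset0 => w [[|n]].
set E := exceed a L; have mE : measurable E := measurable_exceed a L.
pose k := 4 ^+ d / a; have k0 : 0 <= k by rewrite divr_ge0 ?exprn_ge0 // ltW.
have m1 : measurable_fun setT (fun w => (\1_E w : R)%:E).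
  by apply/measurable_EFinP; exact: measurable_indic.
have mkf : measurable_fun setT (fun w => (k * f w)%:E).
  by apply/measurable_EFinP; apply: measurable_funM.
(* By invariance all $(2N)^d$ summands have the same integral. *)
have int_act (g : Omega -> R) N : measurable_fun setT (EFin \o g) ->
    (forall w, 0 <= g w) ->
    (\int[P]_w (\sum_(c <- box 0 N) g (act c w))%:E =
     ((N.*2) ^ d)%:R%:E * \int[P]_w (g w)%:E)%E.
  move=> mg g0; under eq_integral do rewrite -sumEFin.
  rewrite ge0_integral_sum //=; last 2 first.
  - by move=> c; apply: (measurableT_comp mg); exact: measurable_act.
  - by move=> c w _; rewrite lee_fin.
  under eq_bigr => c _.
    rewrite (measure_preserving_integral (f := EFin \o g)) //=; last first.
      exact: measure_preserving_Zd_action.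
    over.
  by rewrite big_const_seq iter_addr_0 count_predT card_box mule_natl.
have : (\int[P]_w (\sum_(c <- box 0 L) \1_E (act c w))%:E <=
        \int[P]_w (\sum_(j <- box 0 L.*2) k * f (act j w))%:E)%E.
  apply: ge0_le_integral => //=.
  - by move=> w _; rewrite lee_fin sumr_ge0.
  - apply/measurable_EFinP; apply: measurable_sum => j.
    by apply: measurableT_comp; [exact: measurable_indic|exact: measurable_act].
  - by apply/measurable_EFinP; exact: measurable_act_sum.
  move=> w _; rewrite lee_fin -mulr_sumr /k mulrAC ler_pdivlMr // mulrC.
  exact/exceed_count/ltW.
rewrite (int_act \1_E) // (int_act (fun w => k * f w)) //; last first.
  by move=> w; rewrite mulr_ge0.
rewrite integral_indic // setIT.
under eq_integral do rewrite EFinM.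
rewrite ge0_integralZl_EFin //; last 2 first.
- by move=> w _; rewrite lee_fin.
- exact/measurable_EFinP.
rewrite -[L.*2.*2]mul2n expnMn natrM EFinM [X in (_ <= X * _)%E]muleC -!muleA.
rewrite lee_pmul2l // ?lte_fin ?ltr0n ?expn_gt0 ?double_gt0 ?L0 //.
by rewrite muleA -EFinM natrX /k mulrA -exprMn -natrM.
Qed.

(** The sets [exceed a L] increase with [L] and the bound on them does not depend on [L], so
    continuity from below applies. *)
Lemma maximal_inequality a : 0 < a ->
  (P (\bigcup_L exceed a L) <= (8 ^+ d / a)%:E * \int[P]_w (f w)%:E)%E.
Proof.
move=> a0; have cvgP : P \o exceed a @ \oo --> P (\bigcup_L exceed a L).
  apply: nondecreasing_cvg_mu.
  - by move=> L; exact: measurable_exceed.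
  - by apply: bigcupT_measurable => L; exact: measurable_exceed.
  - move=> L M LM; apply/subsetPset => w [N /andP[N0 NL] H].
    by exists N => //; rewrite N0 (leq_trans NL).
rewrite -(cvg_lim _ cvgP) //; apply: lime_le.
  by apply/cvg_ex; eexists; exact: cvgP.
by near=> L; exact: exceed_bound.
Unshelve. all: by end_near. Qed.

End MaximalInequality.

(** * Norms and summability of the weights *)

Lemma lnorm_ge (R : realType) d (kappa : \bar R) (x : 'rV[R]_d) i :
  (1 <= kappa)%E -> `|x ord0 i| <= lnorm kappa x.
Proof.
case: kappa => [p| |] //= p1; last by rewrite (bigD1 i) //= le_max lexx.
rewrite lee_fin in p1; have p0 : 0 < p := lt_le_trans ltr01 p1.
have pow_inv : `|x ord0 i| = (`|x ord0 i| `^ p) `^ p^-1.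
  by rewrite -powRrM mulfV ?gt_eqF // powRr1.
rewrite [leLHS]pow_inv; apply: ge0_ler_powR.
- by rewrite invr_ge0 ltW.
- exact: powR_ge0.
- by rewrite nnegrE; apply: sumr_ge0 => k _; exact: powR_ge0.
by rewrite (bigD1 i) //= lerDl; apply: sumr_ge0 => k _; exact: powR_ge0.
Qed.

Lemma nneseries_ub (R : realType) (u : nat -> R) : (forall m, 0 <= u m) ->
  (\sum_(0 <= m <oo) (u m)%:E < +oo)%E ->
  exists2 B, 0 <= B & forall M, \sum_(0 <= m < M) u m <= B.
Proof.
move=> u0 ufin; have s0 : (0 <= \sum_(0 <= m <oo) (u m)%:E)%E.
  by apply: nneseries_ge0 => m _ _; rewrite lee_fin.
exists (fine (\sum_(0 <= m <oo) (u m)%:E)%E); first exact: fine_ge0.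
move=> M; rewrite -lee_fin fineK ?ge0_fin_numE // -sumEFin.
by apply: nneseries_lim_ge => m _ _; rewrite lee_fin.
Qed.

(** A summable [rho] is bounded by some [B], so $1\le B\rho(m)^{-1}$; with $(m+1)^d\le2^dm^{2d}$ for
    $m\ge1$, the series is dominated by the one given by goodness. *)
Lemma good_weight_ub (R : realType) d (theta : R -> R) (rho : nat -> R) :
  (forall x, 0 <= x -> 0 <= theta x) -> good_weight d theta rho ->
  exists2 K, 0 < K &
    forall M, \sum_(0 <= m < M) theta m%:R * m.+1%:R ^+ d <= K.
Proof.
move=> t0 [rho0 rho_fin sum_fin].
have [B B0 rhoB] := nneseries_ub (fun m => ltW (rho0 m)) rho_fin.
have v0 m : 0 <= m%:R ^+ (2 * d) * theta m%:R * (rho m)^-1.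
  by rewrite !mulr_ge0 ?exprn_ge0 ?t0 // invr_ge0 ltW.
have [A A0 sumA] := nneseries_ub v0 sum_fin.
have rho_le m : rho m <= B.
  apply: le_trans (rhoB m.+1); rewrite big_nat_recr //= lerDr.
  by apply: sumr_ge0 => k _; rewrite ltW.
have B2 : 0 <= 2 ^+ d * B by rewrite mulr_ge0 ?exprn_ge0.
have term m : theta m.+1%:R * m.+2%:R ^+ d <=
    2 ^+ d * B * (m.+1%:R ^+ (2 * d) * theta m.+1%:R * (rho m.+1)^-1).
  set t := theta _; have t0' : 0 <= t by exact: t0.
  have h1 : m.+2%:R ^+ d <= 2 ^+ d * m.+1%:R ^+ (2 * d) :> R.
    rewrite exprM -exprMn -(natrX _ m.+1) -natrM lerXn2r ?nnegrE //.
    by rewrite ler_nat -mulnn; lia.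
  have h2 : 1 <= B * (rho m.+1)^-1 by rewrite ler_pdivlMr // mul1r.
  have h3 : 0 <= 2 ^+ d * m.+1%:R ^+ (2 * d) * t.
    by rewrite !mulr_ge0 ?exprn_ge0.
  apply: (le_trans (ler_wpM2l t0' h1)); rewrite mulrC.
  apply: le_trans (ler_peMr h3 h2) _; rewrite le_eqVlt; apply/orP; left.
  by apply/eqP; ring.
(* [theta 0] is the term $m=0$, which escapes the comparison; the final 1 makes the bound strictly
   positive. *)
exists (theta 0 + 2 ^+ d * B * A + 1).
  by rewrite ltr_wpDl // addr_ge0 ?t0 // mulr_ge0.
case=> [|M]; first by rewrite big_geq // !addr_ge0 ?t0 // mulr_ge0.
rewrite big_nat_recl //= expr1n mulr1 -addrA lerD2l.
apply: (@le_trans _ _ (2 ^+ d * B * A)); last by rewrite lerDl.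
apply: (@le_trans _ _ (\sum_(0 <= m < M) 2 ^+ d * B *
    (m.+1%:R ^+ (2 * d) * theta m.+1%:R * (rho m.+1)^-1))).
  by apply: ler_sum => m _; exact: term.
rewrite -mulr_sumr ler_wpM2l //; apply: le_trans (sumA M.+1).
by rewrite [leRHS]big_nat_recl //= lerDr.
Qed.

(** * Comparison of weighted sums with box sums *)

Section WeightedSum.
Context (R : realType) (d : nat) (kappa : \bar R) (theta : R -> R)
  (psi : 'rV[R]_d -> R).
Hypothesis kappa1 : (1 <= kappa)%E.
Hypothesis theta0 : forall x, 0 <= x -> 0 <= theta x.
Hypothesis theta_anti : forall x y, 0 <= x -> x <= y -> theta y <= theta x.
Hypothesis psi_le : forall x, psi x <= theta (lnorm kappa x).

(* Slicing the lattice points according to the integer part m of |j / n|: the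
   points of the m-th slice lie in the box of radius n * (m + 1). *)
Lemma weighted_sum_le (F : 'rV[int]_d -> R) (b K : R) (n : nat)
    (X : {fset 'rV[int]_d}) :
  (0 < d)%N -> (forall j, 0 <= F j) -> 0 <= b -> (0 < n)%N ->
  (forall M, \sum_(0 <= m < M) theta m%:R * m.+1%:R ^+ d <= K) ->
  (forall N, (0 < N)%N -> \sum_(j <- box 0 N) F j <= b * N%:R ^+ d) ->
  \sum_(j <- X) psi (\row_i ((j ord0 i)%:~R / n%:R)) * F j <= b * K * n%:R ^+ d.
Proof.
move=> d0 F0 b0 n0 sumK Fb.
pose x (j : 'rV[int]_d) : 'rV[R]_d := \row_i ((j ord0 i)%:~R / n%:R).
pose l j := Num.truncn (lnorm kappa (x j)).
pose M := (\max_(j <- X) l j).+1.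
(* The norm dominates the absolute value of a coordinate, and one exists because [0 < d]. *)
have lnorm0 j : 0 <= lnorm kappa (x j).
  exact: le_trans (normr_ge0 _) (lnorm_ge (x j) (Ordinal d0) kappa1).
(* The single term $m=l(j)$ suffices: monotonicity of [theta] bounds [psi (x j)] by [theta] at
   [l j], and the other terms are non-negative. *)
have term j : j \in X -> psi (x j) * F j <=
    \sum_(0 <= m < M) theta m%:R * ((j \in box 0 (n * m.+1))%:R * F j).
  move=> jX; have lM : (l j < M)%N by rewrite ltnS; apply: leq_bigmax_seq.
  have /andP[l1 l2] := truncn_itv (lnorm0 j).
  have jbox : j \in box 0 (n * (l j).+1).
    apply/in_boxP => i; have := le_lt_trans (lnorm_ge (x j) i kappa1) l2.
    rewrite !mxE normrM normfV normr_nat ltr_pdivrMr ?ltr0n //.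
    rewrite -intr_norm -natrM pmulrn ltr_int mulnC.
    by move: (n * _)%N (j _ _) => N y; lia.
  rewrite big_mkord (bigD1 (Ordinal lM)) //= jbox mul1r ler_wpDr //.
    by apply: sumr_ge0 => m _; rewrite !mulr_ge0 ?theta0.
  by rewrite ler_wpM2r // (le_trans (psi_le _)) // theta_anti.
have slice N :
    \sum_(j <- X) (j \in box 0 N)%:R * F j <= \sum_(j <- box 0 N) F j.
  have -> : \sum_(j <- X) (j \in box 0 N)%:R * F j =
      \sum_(j <- [fset j in X | j \in box 0 N]%fset) F j.
    rewrite big_fset /= [RHS]big_mkcond /=; apply: eq_bigr => j _.
    by case: ifP; rewrite ?mul1r ?mul0r.
  rewrite [leRHS](@big_fsetDS _ _ [fset j in X | j \in box 0 N]%fset).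
    by rewrite lerDl sumr_ge0.
  by apply/fsubsetP => j; rewrite !inE => /andP[].
apply: (@le_trans _ _ (\sum_(j <- X) \sum_(0 <= m < M)
    theta m%:R * ((j \in box 0 (n * m.+1))%:R * F j))).
  by rewrite big_seq [leRHS]big_seq; apply: ler_sum => j; exact: term.
rewrite exchange_big /=.
apply: (@le_trans _ _ (\sum_(0 <= m < M)
    b * n%:R ^+ d * (theta m%:R * m.+1%:R ^+ d))).
  apply: ler_sum => m _; rewrite -mulr_sumr mulrCA ler_wpM2l ?theta0 //.
  apply: le_trans (slice _) _; apply: le_trans (Fb _ _) _.
    by rewrite muln_gt0 n0.
  by rewrite natrM exprMn mulrA.
by rewrite -mulr_sumr mulrAC ler_wpM2r ?exprn_ge0 // ler_wpM2l.
Qed.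

End WeightedSum.

(** * The weighted maximal inequality *)

(** As [\esum] is a supremum of finite sums, this reduces the sum over $\mathbb Z^d$ to finite sets
    of lattice points. *)
Lemma gt_esumP (R : realType) (K : choiceType) (F : K -> R) (a : R) :
  (a%:E < \esum_(j in [set: K]) (F j)%:E)%E <->
  exists X : {fset K}, a < \sum_(j <- X) F j.
Proof.
split=> [/ereal_sup_gtP[_ [X [finX _] <-]]|[X aX]].
  by rewrite fsbig_finite //= sumEFin lte_fin; exists (fset_set X).
apply/ereal_sup_gtP; exists (\sum_(j \in [set` X]) (F j)%:E)%E.
  by exists [set` X].
by rewrite fsbig_finite //= set_fsetK sumEFin lte_fin.
Qed.

Theorem theorem2p2 (R : realType) (d : nat) (kappa : \bar R)
    (theta : R -> R) (rho : nat -> R) :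
  (0 < d)%N ->
  (1 <= kappa)%E ->
  d_good d theta ->
  good_weight d theta rho ->
  exists2 C : R, 0 < C &
    forall (disp : measure_display) (Omega : measurableType disp)
      (P : probability Omega R) (T Tinv : 'I_d -> Omega -> Omega),
    (forall i, cancel (T i) (Tinv i)) ->
    (forall i, cancel (Tinv i) (T i)) ->
    (forall i, measure_preserving P (T i)) ->
    (forall i, measure_preserving P (Tinv i)) ->
    (forall i k, T i \o T k =1 T k \o T i) ->
    forall psi : 'rV[R]_d -> R,
    (forall x, 0 <= psi x) ->
    (forall x, psi x <= theta (lnorm kappa x)) ->
    forall f : Omega -> R,
    f \in Lfun P 1 ->
    (forall w, 0 <= f w) ->
    forall alpha : R, 0 < alpha ->
    (P [set w | alpha%:E <
          ereal_sup [set ((n%:R ^+ d)^-1)%:E *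
              \esum_(j in [set: 'rV[int]_d])
                 (psi (\row_i ((j ord0 i)%:~R / n%:R))
                  * f (Zd_action T Tinv j w))%:E
            | n in [set n : nat | (0 < n)%N]]]
     <= C%:E * 'N[P]_1[EFin \o f] / alpha%:E)%E.
Proof.
move=> d0 kappa1 [theta0 theta_anti _] rho_good.
have [K K0 sumK] := good_weight_ub theta0 rho_good.
(* The box inequality will be used at level $b=\alpha/K$, where its constant $8^d/b$ equals
   $8^dK/\alpha$. *)
exists (8 ^+ d * K); first by rewrite mulr_gt0 ?exprn_gt0.
move=> disp Omega P T Tinv TK TVK PT PTinv Tcomm psi psi0 psi_le f.
move=> /Lfun1_integrable/measurable_int/measurable_EFinP mf f0 alpha alpha0.
set E := [set w | _].
pose S n (X : {fset 'rV[int]_d}) := [set w | alpha * n%:R ^+ d <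
  \sum_(j <- X)
    psi (\row_i ((j ord0 i)%:~R / n%:R)) * f (Zd_action T Tinv j w)].
have ES : E = \bigcup_(n in [set n | (0 < n)%N]) \bigcup_X S n X.
  apply/seteqP; split=> w.
    move=> /ereal_sup_gtP[_ [n n0 <-]].
    have nd0 : 0 < n%:R ^+ d :> R by rewrite exprn_gt0 // ltr0n.
    rewrite lte_pdivlMl // -EFinM mulrC => /gt_esumP[X aX].
    by exists n => //; exists X.
  move=> [n n0 [X _ aX]]; apply/ereal_sup_gtP; eexists; first by exists n.
  have nd0 : 0 < n%:R ^+ d :> R by rewrite exprn_gt0 // ltr0n.
  by rewrite lte_pdivlMl // -EFinM mulrC; apply/gt_esumP; exists X.
(* There are only countably many finite subsets of $\mathbb Z^d$, so the union is countable. *)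
have mE : measurable E.
  rewrite ES; apply: bigcup_measurable => n _.
  apply: countable_bigcupT_measurable => // X.
  exact/measurable_gt/measurable_act_sum.
pose b := alpha / K; have b0 : 0 < b by rewrite divr_gt0.
have sub : E `<=` \bigcup_L exceed T Tinv f b L.
  (* If no box sum exceeds $bN^d$, every weighted sum at scale [n] is at most $bKn^d=\alpha n^d$,
     against the choice of [X]. *)
  rewrite ES => w [n /= n0 [X _ /= aX]]; apply: contrapT => notin.
  move: aX; apply/negP; rewrite -leNgt.
  rewrite [in leRHS](_ : alpha = b * K); last by rewrite divfK ?gt_eqF.
  apply: (weighted_sum_le kappa1 theta0 theta_anti psi_le) => // [|N N0].
    exact: ltW.
  rewrite leNgt; apply/negP => H; apply: notin; exists N => //.
  by exists N => //; rewrite N0 leqnn.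
apply: (@le_trans _ _ (P (\bigcup_L exceed T Tinv f b L))).
  apply: le_measure; rewrite ?inE //.
  by apply: bigcupT_measurable => L; exact: measurable_exceed.
apply: (le_trans (maximal_inequality TK TVK PT PTinv Tcomm mf f0 b0)).
rewrite Lnorm1 inver gt_eqF // muleAC -EFinM /b invf_div mulrA.
by under [in leRHS]eq_integral do rewrite /= ger0_norm //.
Qed.
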